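(* Let $A\colon\mathcal{X}\to2^{\mathcal{X}^*}$, let $\varnothing\neq\mathcal{D}\subset\mathcal{X}$, let $W\colon\mathcal{D}\to\mathcal{X}^*$, let $x\in\mathcal{D}$, let $u^*\in\mathcal{X}^*$, let $\gamma\in\,]0,+\infty[$, let $\alpha\in\,]0,+\infty[$, and let $\beta\in\,]0,+\infty[$. Suppose that $z\in J^W_{\gamma(A-u^* )}x$ and that $W$ is $(\alpha,\beta)$-jointly strongly monotone. Then $$H_A(x,u^* )\geq\frac{\langle x-z,Wx-Wz\rangle}{\gamma}\geq\frac{\min\{\alpha,\beta\}}{2}d^2_{\operatorname{gra}A,\gamma}(x,u^* ).$$
   Context: $\mathcal{X}\neq\{0\}$ is a reflexive real Banach space with topological dual $\mathcal{X}^*$, and $\langle\cdot,\cdot\rangle$ is the canonical duality pairing. For $A\colon\mathcal{X}\to 2^{\mathcal{X}^*}$: $\operatorname{gra}A=\{(x,x^* )\mid x^*\in Ax\}$, $A^{-1}x^*=\{x\mid x^*\in Ax\}$; images of sets and compositions are unions of images. A map $W\colon\mathcal{D}\to\mathcal{X}^*$ is identified with the set-valued operator equal to $\{Wx\}$ for $x\in\mathcal{D}$ and $\varnothing$ otherwise. The Haraux function is $H_A\colon\mathcal{X}\times\mathcal{X}^*\to[-\infty,+\infty]\colon(x,u^* )\mapsto\sup_{(y,y^* )\in\operatorname{gra}A}\langle x-y,y^*-u^*\rangle$. $\gamma(A-u^* )$ is the operator $x\mapsto\{\gamma(x^*-u^* )\mid x^*\in Ax\}$. The warped resolvent of $A$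 with kernel $K\colon\mathcal{X}\to2^{\mathcal{X}^*}$ is $J_A^K=(K+A)^{-1}\circ K$. $W\colon\mathcal{D}\to\mathcal{X}^*$ is $(\alpha,\beta)$-jointly strongly monotone if $\langle x-y,Wx-Wy\rangle\geq\frac{\alpha}{2}\|x-y\|^2+\frac{\beta}{2}\|Wx-Wy\|^2$ for all $x,y\in\mathcal{D}$. For $\gamma\in\,]0,+\infty[$, set $|||(x,x^* )|||_\gamma=\sqrt{\|x\|^2/\gamma+\gamma\|x^*\|^2}$ for $(x,x^* )\in\mathcal{X}\times\mathcal{X}^*$, and for $\boldsymbol{C}\subset\mathcal{X}\times\mathcal{X}^*$ set $d_{\boldsymbol{C},\gamma}(x,x^* )=\inf_{(y,y^* )\in\boldsymbol{C}}|||(x,x^* )-(y,y^* )|||_\gamma\in[0,+\infty]$. *)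

(* Defs.v *)
From HB Require Import structures.
From mathcomp Require Import all_boot all_order all_algebra.
From mathcomp Require Import all_classical all_reals all_analysis.
Import Order.TTheory GRing.Theory Num.Theory.
Import numFieldNormedType.Exports.

Set Implicit Arguments.
Unset Strict Implicit.
Unset Printing Implicit Defensive.

Local Open Scope classical_set_scope.
Local Open Scope ring_scope.

Section dual_space.
Context {R : realType} (X : normedModType R).

Definition continuous_linear : {pred X -> R^o} :=
  [pred f : X -> R^o | `[< linear f /\ continuous f >]].

Record dual := Dual {
  dual_fun :> X -> R^o ;
  dual_funP : dual_fun \in continuous_linear }.

HB.instance Definition _ := [isSub for dual_fun].
HB.instance Definition _ := [Choice of dual by <:].

Lemma continuous_linear_submod_closed : submod_closed continuous_linear.
Proof.
split=> [|a f g].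
  rewrite inE; split; last by move=> x; exact: cvg_cst.
  by move=> k x y; rewrite scaler0 addr0.
rewrite !inE => -[lf cf] [lg cg]; split.
  move=> k x y; rewrite !fctE /= lf lg !scalerDr !scalerA (mulrC k).
  by rewrite addrACA.
move=> x; apply: cvgD; last exact: cg.
by apply: cvgZr; exact: cf.
Qed.

HB.instance Definition _ := GRing.isSubmodClosed.Build R (X -> R^o)
  continuous_linear continuous_linear_submod_closed.
HB.instance Definition _ := [SubChoice_isSubLmodule of dual by <:].

Definition dual_norm (f : dual) : R :=
  sup [set `|f x| | x in [set x : X | `|x| <= 1]].

Lemma dual_linear (f : dual) : linear f.
Proof. by have := dual_funP f; rewrite inE => -[]. Qed.

Lemma dual_continuous (f : dual) : continuous f.
Proof. by have := dual_funP f; rewrite inE => -[]. Qed.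

HB.instance Definition _ (f : dual) :=
  GRing.isLinear.Build R X R^o *:%R f (dual_linear f).

Lemma dualP (f g : dual) : (forall x, f x = g x) -> f = g.
Proof. by move=> fg; apply/val_inj/funext. Qed.

Lemma dual_has_sup (f : dual) :
  has_sup [set `|f x| | x in [set x : X | `|x| <= 1]].
Proof.
split; first by exists `|f 0|, 0 => //=; rewrite normr0.
have /linear_boundedP : bounded_near f (nbhs (0 : X)).
  exact/linear_bounded_continuous/dual_continuous.
move=> /pinfty_ex_gt0[M M0 fM]; exists M => _ [x /= x1 <-].
by rewrite (le_trans (fM x))// ger_pMr.
Qed.

Lemma dual_norm_ub (f : dual) (x : X) : `|x| <= 1 -> `|f x| <= dual_norm f.
Proof.
by move=> x1; apply: ub_le_sup; [exact: (dual_has_sup f).2|exists x].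
Qed.

Lemma dual_norm_le (f : dual) (M : R) :
  (forall x, `|x| <= 1 -> `|f x| <= M) -> dual_norm f <= M.
Proof.
move=> fM; apply: ge_sup; first exact: (dual_has_sup f).1.
by move=> _ [x x1 <-]; exact: fM.
Qed.

Lemma dual_norm_ge0 (f : dual) : 0 <= dual_norm f.
Proof.
by rewrite (le_trans (normr_ge0 (f 0)))// dual_norm_ub// normr0.
Qed.

Lemma ler_dual_norm (f : dual) (x : X) : `|f x| <= dual_norm f * `|x|.
Proof.
have [->|x0] := eqVneq x 0; first by rewrite linear0 !normr0 mulr0.
rewrite -ler_pdivrMr ?normr_gt0// mulrC.
have xV0 : 0 <= `|x|^-1 by rewrite invr_ge0.
have -> : `|x|^-1 * `|f x| = `|f (`|x|^-1 *: x)|.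
  by rewrite linearZ /= normrZ ger0_norm.
by apply: dual_norm_ub; rewrite normrZ ger0_norm// mulVf// normr_eq0.
Qed.

Lemma dual_normD (f g : dual) : dual_norm (f + g) <= dual_norm f + dual_norm g.
Proof.
apply: dual_norm_le => x x1.
by rewrite (le_trans (ler_normD _ _))// lerD// dual_norm_ub.
Qed.

Lemma dual_normZ_le (k : R) (f : dual) :
  dual_norm (k *: f) <= `|k| * dual_norm f.
Proof.
apply: dual_norm_le => x x1.
by rewrite [X in X <= _]normrM ler_wpM2l// dual_norm_ub.
Qed.

Lemma dual_normZ (k : R) (f : dual) : dual_norm (k *: f) = `|k| * dual_norm f.
Proof.
apply/eqP; rewrite eq_le dual_normZ_le /=.
have [->|k0] := eqVneq k 0; first by rewrite normr0 mul0r dual_norm_ge0.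
rewrite -ler_pdivlMl ?normr_gt0// -normfV.
by rewrite (le_trans _ (dual_normZ_le _ _))// scalerA mulVf// scale1r.
Qed.

Lemma dual_norm0_eq0 (f : dual) : dual_norm f = 0 -> f = 0.
Proof.
move=> f0; apply: dualP => x; apply/eqP.
by rewrite -normr_le0 (le_trans (ler_dual_norm f x))// f0 mul0r.
Qed.

HB.instance Definition _ := Lmodule_isNormed.Build R dual
  dual_normD dual_normZ dual_norm0_eq0.

Lemma dual_normE (f : dual) : `|f| = dual_norm f.
Proof. by []. Qed.

End dual_space.

Definition pairing {R : realType} {X : normedModType R}
  (x : X) (f : dual X) : R := f x.

Section reflexivity.
Context {R : realType} {X : normedModType R}.

Lemma pairing_continuous_linear (x : X) :
  (pairing x : dual X -> R^o) \in @continuous_linear R (dual X).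
Proof.
rewrite inE.
have lx : linear (pairing x : dual X -> R^o) by [].
split=> //.
pose L := GRing.isLinear.Build R (dual X) R^o *:%R (pairing x) lx.
pose ev : {linear dual X -> R^o} := HB.pack (pairing x : dual X -> R^o) L.
apply: (@bounded_linear_continuous _ _ _ ev); apply/linear_boundedP.
near=> r => f; rewrite (le_trans (ler_dual_norm f x))// mulrC ler_wpM2r ?dual_norm_ge0//.
Unshelve. all: by end_near. Qed.

Definition bidual_embedding (x : X) : dual (dual X) :=
  Dual (pairing_continuous_linear x).

End reflexivity.

Definition reflexive_space {R : realType} (X : normedModType R) : Prop :=
  forall phi : dual (dual X), exists x : X, bidual_embedding x = phi.

Section set_valued_operators.
Context {T U V : Type}.

(* an operator T -> 2^U is a function T -> set U *)
Definition gra (A : T -> set U) : set (T * U) := [set p | A p.1 p.2].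

Definition op_inv (A : T -> set U) : U -> set T := fun u => [set x | A x u].

Definition op_comp (B : U -> set V) (A : T -> set U) : T -> set V :=
  fun x => \bigcup_(u in A x) B u.

(* The map W : D -> U is given by a total function, of which only the values
   on D are used. *)
Definition op_of_map (D : set T) (W : T -> U) : T -> set U :=
  fun x => [set u | D x /\ u = W x].

End set_valued_operators.

Definition op_add {T : Type} {V : zmodType} (A B : T -> set V) : T -> set V :=
  fun x => [set a + b | a in A x & b in B x].

Section operators_to_dual.
Context {R : realType} {X : normedModType R}.
Implicit Types (A K : X -> set (dual X)) (D : set X).

Definition op_shift_scale (gamma : R) A (u : dual X) : X -> set (dual X) :=
  fun x => [set gamma *: (a - u) | a in A x].

Definition haraux A (x : X) (u : dual X) : \bar R :=
  ereal_sup [set (pairing (x - p.1) (p.2 - u))%:E | p in gra A].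

Definition warped_resolvent K A : X -> set X :=
  op_comp (op_inv (op_add K A)) K.

Definition jointly_strongly_monotone (alpha beta : R) D (W : X -> dual X) :=
  forall x y, D x -> D y ->
    alpha / 2 * `|x - y| ^+ 2 + beta / 2 * `|W x - W y| ^+ 2 <=
    pairing (x - y) (W x - W y).

Definition scaled_norm (gamma : R) (p : X * dual X) : R :=
  Num.sqrt (`|p.1| ^+ 2 / gamma + gamma * `|p.2| ^+ 2).

Definition scaled_dist (gamma : R) (C : set (X * dual X)) (p : X * dual X)
    : \bar R :=
  ereal_inf [set (scaled_norm gamma (p - q))%:E | q in C].

End operators_to_dual.

(* Main.v *)
Require Import Defs.
From mathcomp Require Import all_boot all_order all_algebra.
From mathcomp Require Import all_classical all_reals all_analysis.
From mathcomp Require Import ring.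
Import Order.TTheory GRing.Theory Num.Theory.
Import numFieldNormedType.Exports.
Local Open Scope classical_set_scope.
Local Open Scope ring_scope.

(** A warped resolvent step is a point of the graph in disguise: unfolding
[z \in (W + gamma (A - u))^-1 (W x)] says that
[a = u + gamma^-1 (W x - W z)] belongs to [A z] (lemma
[warped_resolvent_graph]).  Both inequalities then come from evaluating an
extremum at the single competitor [(z, a)].  In the supremum defining the
Haraux function it contributes exactly [<x - z, W x - W z> / gamma].  In the
infimum defining the distance it contributes, after squaring,
[|x - z|^2 / gamma + gamma |a - u|^2], whose second term is
[|W x - W z|^2 / gamma]; joint strong monotonicity of [W], divided by [gamma]
and with [alpha] and [beta] both lowered to their minimum, says that half this
minimum times that sum is at most [<x - z, W x - W z> / gamma]. *)

(** Dividing the resolvent inclusion by [gamma] isolates the element of [A z];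
[z] lies in [D] because the operator induced by [W] is empty-valued off
[D], which is what later allows monotonicity to be applied at [z]. *)
Lemma warped_resolvent_graph (R : realType) (X : normedModType R)
    (A : X -> set (dual X)) (D : set X) (W : X -> dual X) (x z : X)
    (u : dual X) (gamma : R) :
  gamma != 0 ->
  warped_resolvent (op_of_map D W) (op_shift_scale gamma A u) x z ->
  D z /\ A z (u + gamma^-1 *: (W x - W z)).
Proof.
move=> g0 [_ [_ ->] [_ [Dz ->] [_ [a Aza <-] <-]]]; split=> //.
by rewrite addrAC subrr add0r scalerA mulVf// scale1r addrC subrK.
Qed.

Lemma haraux_ge (R : realType) (X : normedModType R) (A : X -> set (dual X))
    (x y : X) (u v : dual X) :
  A y v -> ((pairing (x - y) (v - u))%:E <= haraux A x u)%E.
Proof. by move=> Ayv; apply: ereal_sup_ubound; exists (y, v). Qed.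

(** Squaring is monotone here because the distance, an infimum of
nonnegative numbers, is nonnegative. *)
Lemma scaled_dist_sqr_le (R : realType) (X : normedModType R) (gamma : R)
    (C : set (X * dual X)) (p q : X * dual X) :
  0 <= gamma -> C q ->
  (scaled_dist gamma C p ^+ 2 <=
    (`|p.1 - q.1| ^+ 2 / gamma + gamma * `|p.2 - q.2| ^+ 2)%:E)%E.
Proof.
move=> g0 Cq.
have d0 : (0 <= scaled_dist gamma C p)%E.
  by apply/ereal_infP => _ [r _ <-]; rewrite lee_fin sqrtr_ge0.
have dq : (scaled_dist gamma C p <= (scaled_norm gamma (p - q))%:E)%E.
  by apply: ereal_inf_lbound; exists q.
apply: (@le_trans _ _ ((scaled_norm gamma (p - q))%:E ^+ 2)%E).
  by rewrite !expe2; exact: lee_pmul.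
by rewrite -EFin_expe sqr_sqrtr// addr_ge0 ?divr_ge0 ?mulr_ge0 ?sqr_ge0.
Qed.

Theorem proposition5p17 (R : realType) (X : completeNormedModType R)
    (X_neq0 : exists x : X, x != 0) (X_reflexive : reflexive_space X)
    (A : X -> set (dual X)) (D : set X) (D_neq0 : D !=set0)
    (W : X -> dual X) (x : X) (Dx : D x) (u : dual X)
    (gamma alpha beta : R)
    (gamma_gt0 : 0 < gamma) (alpha_gt0 : 0 < alpha) (beta_gt0 : 0 < beta)
    (z : X)
    (Jz : warped_resolvent (op_of_map D W) (op_shift_scale gamma A u) x z)
    (W_mono : jointly_strongly_monotone alpha beta D W) :
  (haraux A x u >= (pairing (x - z) (W x - W z) / gamma)%:E)%E /\
  ((pairing (x - z) (W x - W z) / gamma)%:E >=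
     (Num.min alpha beta / 2)%:E * scaled_dist gamma (gra A) (x, u) ^+ 2)%E.
Proof.
have gamma_neq0 : gamma != 0 by rewrite gt_eqF.
have [Dz Az] := warped_resolvent_graph _ _ _ _ _ _ _ _ _ gamma_neq0 Jz.
split.
  have := haraux_ge _ _ _ x _ u _ Az.
  (* a multiple of a functional is evaluated pointwise, by conversion *)
  by rewrite addrAC subrr add0r mulrC.
have m_ge0 : (0 <= (Num.min alpha beta / 2)%:E)%E.
  by rewrite lee_fin divr_ge0// le_min !ltW.
have := @scaled_dist_sqr_le _ _ _ (gra A) (x, u) (z, _) (ltW gamma_gt0) Az.
move/(lee_wpmul2l m_ge0)/le_trans; apply.
rewrite -EFinM lee_fin /= opprD addrA subrr add0r normrN normrZ.
rewrite gtr0_norm ?invr_gt0//.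
set a := `|x - z|; set b := `|W x - W z|.
rewrite (_ : _ + _ = (a ^+ 2 + b ^+ 2) / gamma); last by field.
rewrite mulrA ler_pM2r ?invr_gt0//.
apply: le_trans (W_mono _ _ Dx Dz).
by rewrite mulrDr lerD// ler_wpM2r ?sqr_ge0// ler_pM2r ?invr_gt0// ge_min lexx
  ?orbT.
Qed.
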